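(* Let $G$ be a countable group that is not locally finite. Then for every $n\ge1$ there is a fair polytile $(T_1,\dots,T_k)$ of $G$ with $|T_1|=n$. Furthermore, if $F\subseteq G$ is finite then for all sufficiently large $n$ there is a fair polytile $(T_1,\dots,T_k)$ of $G$ with $F\subseteq T_1$ and $|T_1|=n$.
   Context: A group is locally finite if every finite subset generates a finite subgroup. For a countable group $G$, a tuple $(T_1,\dots,T_k)$ of finite subsets of $G$, each containing $1_G$, is a polytile if there are non-empty sets $\Delta_1,\dots,\Delta_k\subseteq G$ such that $G$ is the disjoint union $\coprod_{1\le i\le k,\ \delta\in\Delta_i}\delta T_i$. It is fair if all $T_i$ have the same cardinality. *)

(* Defs.v *)
From mathcomp Require Import all_boot all_order.
From mathcomp Require Import finmap.
Set Implicit Arguments. Unset Strict Implicit. Unset Printing Implicit Defensive.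
Local Open Scope fset_scope.

Record group_str (G : Type) := GroupStr {
  gmul : G -> G -> G;
  gone : G;
  ginv : G -> G;
  gmulA : forall x y z, gmul x (gmul y z) = gmul (gmul x y) z;
  gmul1g : forall x, gmul gone x = x;
  gmulVg : forall x, gmul (ginv x) x = gone
}.

Inductive generated (G : Type) (gr : group_str G) (S : G -> Prop) : G -> Prop :=
| gen_in x : S x -> generated gr S x
| gen_one : generated gr S (gone gr)
| gen_mul x y : generated gr S x -> generated gr S y -> generated gr S (gmul gr x y)
| gen_inv x : generated gr S x -> generated gr S (ginv gr x).

Definition locally_finite (G : choiceType) (gr : group_str G) : Prop :=
  forall A : {fset G}, exists s : seq G,
    forall x, generated gr (fun y => y \in A) x -> x \in s.

Definition in_ltrans (G : choiceType) (gr : group_str G) (d : G) (T : {fset G}) (x : G) :=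
  exists2 t, t \in T & x = gmul gr d t.

(* (T_0, ..., T_{k-1}) (0-indexed version of (T_1,...,T_k)) is a polytile:
   k >= 1, each T_i is a finite set containing 1, and there are non-empty
   Delta_i with G the disjoint union of the d T_i, i < k, d in Delta_i. *)
Definition polytile (G : choiceType) (gr : group_str G) (k : nat)
    (T : nat -> {fset G}) : Prop :=
  0 < k /\
  (forall i, i < k -> gone gr \in T i) /\
  exists Delta : nat -> G -> Prop,
    (forall i, i < k -> exists d, Delta i d) /\
    (forall x, exists i d, [/\ i < k, Delta i d & in_ltrans gr d (T i) x]) /\
    (forall x i j d e, i < k -> j < k -> Delta i d -> Delta j e ->
        in_ltrans gr d (T i) x -> in_ltrans gr e (T j) x -> i = j /\ d = e).

Definition fair_polytile (G : choiceType) (gr : group_str G) (k : nat)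
    (T : nat -> {fset G}) : Prop :=
  polytile gr k T /\ (forall i, i < k -> #|` T i| = #|` T 0|).

(* Main.v *)
Require Import Defs.
From mathcomp Require Import all_boot all_order.
From mathcomp Require Import finmap boolp.
Set Implicit Arguments.
Unset Strict Implicit.
Unset Printing Implicit Defensive.

(* Let [A] be a finite set generating an infinite subgroup.  In the Cayley graph
   of [A] on [G], all components (the left cosets of [<A>]) are infinite, and a
   breadth-first forest yields a map [p], moving points a bounded distance, for
   which every point has finitely many [p]-descendants.  Sending
   surpluses of fewer than [n] points along [p], every vertex packs what it holds
   into blocks of exactly [n] nearby points, so [G] is partitioned into [n]-sets
   that, up to translation, have finitely many shapes.  To obtain a tile
   containing [F], first remove one set [D] containing [F] and [1], with
   [#|D| = n] and [D] closed under [p]-preimages: [p] still acts on the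
   complement of [D].  Such [D] exist for all large [n], because the finite
   closure of [F] and [1] can be enlarged one point at a time. *)

(** * Finite height, and a flow whose descendant trees are finite *)

(** Bounded accessibility: chains of [R]-predecessors ending at [v] have fewer than [k] steps, so
    [k = 1] says that [v] has no predecessor. *)
Fixpoint height_lt (V : Type) (R : V -> V -> Prop) (k : nat) (v : V) : Prop :=
  if k is k'.+1 then forall u, R u v -> height_lt R k' u else False.

Lemma height_lt_leq (V : Type) (R : V -> V -> Prop) k m v :
  k <= m -> height_lt R k v -> height_lt R m v.
Proof.
elim: k m v => [//|k IH] [//|m] v km /= hv u Ruv.
exact: IH (hv u Ruv).
Qed.

(** König's argument: finitely many bounds have a maximum. In contrapositive form, a vertex of
    unbounded height has a predecessor of unbounded height. *)
Lemma height_lt_finite_branching (V : eqType) (R : V -> V -> Prop) (s : seq V) v :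
    (forall u, R u v -> u \in s) ->
    (forall u, R u v -> exists k, height_lt R k u) ->
  exists k, height_lt R k v.
Proof.
move=> Rs hR.
suff [k hk] : exists k, forall u, u \in s -> R u v -> height_lt R k u.
  by exists k.+1 => u Ruv; apply: hk => //; exact: Rs.
elim: s {Rs} => [|w s [k hk]]; first by exists 0.
have [/hR [m hm]|nR] := EM (R w v); last first.
  by exists k => u; rewrite inE => /orP[/eqP-> /nR|/hk].
exists (maxn k m) => u; rewrite inE => /orP[/eqP-> _|us Ruv].
  exact: height_lt_leq (leq_maxr k m) hm.
exact: height_lt_leq (leq_maxl k m) (hk u us Ruv).
Qed.

Definition preim_rel (V : Type) (p : V -> V) (u v : V) : Prop := p u = v.

Lemma height_lt_iter (V : Type) (p : V -> V) k v j u :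
  height_lt (preim_rel p) k v -> iter j p u = v -> j < k.
Proof.
elim: k v j => [//|k IH] v [//|j] /= hv e.
exact: IH (hv _ e) _.
Qed.

Lemma height_lt_acyclic (V : Type) (p : V -> V) k v m :
  height_lt (preim_rel p) k v -> iter m.+1 p v <> v.
Proof.
elim: k v => [//|k IH] v hv e.
apply: (IH (iter m p v)); first exact: hv.
by rewrite -iterD addnC iterD e.
Qed.

(* Two kinds of vertices occur in the forest [q]: those with a subtree of finite
   height keep [q] as their parent, the others flow down to a child of infinite
   height.  A vertex of the second kind then receives the finite subtrees hanging
   off a path of at most [l v] vertices. *)
Lemma flow_to_infinity (V : eqType) (q : V -> V) (l : V -> nat) (nb : V -> seq V) :
    let R u v := q u = v /\ l u = (l v).+1 in
    (forall v, 0 < l v -> l v = (l (q v)).+1) ->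
    (forall u, u \in nb (q u)) ->
    (forall r k, l r = 0 -> ~ height_lt R k r) ->
  exists p : V -> V, (forall v, p v = q v \/ q (p v) = v) /\
    forall v, exists k, height_lt (preim_rel p) k v.
Proof.
move=> R lq nbP rootP.
pose tame v := exists k, height_lt R k v.
have wild_child v : ~ tame v -> exists u, R u v /\ ~ tame u.
  move=> wv; apply: contrapT => no.
  apply: wv; apply: (height_lt_finite_branching (s := nb v)) => u Ruv.
    by case: Ruv => <- _.
  by apply: contrapT => wu; apply: no; exists u.
have wild_parent v : ~ tame v -> 0 < l v -> ~ tame (q v).
  move=> wv lv [[//|k] hk]; apply: wv; exists k; apply: hk.
  by split=> //; exact: lq.
have tame_pos v : tame v -> 0 < l v.
  by case=> k hk; case e: (l v) => //; case: (rootP v k e).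
have /choice [p pP] : forall v, exists u,
    (tame v /\ u = q v) \/ (~ tame v /\ R u v /\ ~ tame u).
  move=> v; have [tv|wv] := EM (tame v); first by exists (q v); left.
  by have [u ?] := wild_child v wv; exists u; right.
exists p; split=> [v|].
  by case: (pP v) => [[_ ->]|[_ [[-> _] _]]]; [left|right].
have tameP k v : height_lt R k v -> height_lt (preim_rel p) k v.
  elim: k v => [//|k IH] v hv u; rewrite /preim_rel => pu.
  case: (pP u) => [[tu pq]|[_ [_ wu]]]; last first.
    by case: wu; rewrite pu; exists k.+1.
  apply/IH/hv; split; first by rewrite -pq.
  by rewrite -pu pq; apply/lq/tame_pos.
have preim_nb u v : p u = v -> u \in q v :: nb v.
  move=> pu; rewrite inE.
  case: (pP u) => [[_ pq]|[_ [[<- _] _]]]; last by rewrite pu eqxx.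
  by rewrite -pu pq nbP orbT.
(* A wild preimage [u] of [v] has [l v = (l u).+1], so induction on the level handles wild
   preimages; [tameP] handles the others. *)
move=> v; have [m] := ubnP (l v); elim: m v => [//|m IH] v lv.
have [[k hk]|wv] := EM (tame v); first by exists k; exact: tameP.
apply: (height_lt_finite_branching (s := q v :: nb v)) => [u /preim_nb//|u].
rewrite /preim_rel => pu; have [[k hk]|wu] := EM (tame u).
  by exists k; exact: tameP.
case: (pP u) => [[//]|[_ [[_ lp] _]]]; apply: IH.
by rewrite -pu lp in lv.
Qed.

(** * Finite sets closed under preimages *)

Section LowerSets.
Variables (V : eqType) (p : V -> V) (nb : V -> seq V).
Hypothesis preim_nb : forall u, u \in nb (p u).
Hypothesis height : forall v, exists k, height_lt (preim_rel p) k v.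

Definition lower (s : seq V) := forall u, p u \in s -> u \in s.

Lemma lower_cover1 v : exists s, lower s /\ v \in s.
Proof.
have [k] := height v; elim: k v => [//|k IH] v hv.
suff [s [ls sP]] : exists s, lower s /\ forall u, u \in nb v -> p u = v -> u \in s.
  exists (v :: s); split; last by rewrite mem_head.
  move=> u; rewrite !inE => /orP[/eqP pu|/ls->]; last by rewrite orbT.
  by rewrite sP ?orbT// -pu.
elim: (nb v) => [|w r [s [ls sP]]]; first by exists [::]; split.
have [pw|pw] := eqVneq (p w) v; last first.
  exists s; split=> // u; rewrite inE => /orP[/eqP->|/sP//].
  by move=> e; rewrite e eqxx in pw.
have [t [lt wt]] := IH w (hv w pw).
exists (t ++ s); split=> u; rewrite !mem_cat.
  by case/orP => [/lt|/ls] ->; rewrite ?orbT.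
by rewrite inE => /orP[/eqP->|/sP us /us->]; rewrite ?wt ?orbT.
Qed.

Lemma lower_cover (r : seq V) : exists s, lower s /\ {subset r <= s}.
Proof.
elim: r => [|v r [s [ls rs]]]; first by exists [::]; split.
have [t [lt vt]] := lower_cover1 v; exists (t ++ s); split=> u; rewrite mem_cat.
  by rewrite mem_cat => /orP[/lt|/ls] ->; rewrite ?orbT.
by rewrite inE => /orP[/eqP->|/rs->]; rewrite ?vt ?orbT.
Qed.

(** Passing from [z] to preimages outside [s] lowers the height, so it stops at a point whose
    preimages all lie in [s]; this point can be added. *)
Lemma lower_extend s z : z \notin s -> lower s ->
  exists x, x \notin s /\ lower (x :: s).
Proof.
move=> zs ls; have [k] := height z; elim: k z zs => [//|k IH] z zs hz.
have [[u [pu us]]|no] := EM (exists u, p u = z /\ u \notin s).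
  exact: IH us (hz u pu).
exists z; split=> // u; rewrite !inE => /orP[/eqP pu|/ls->]; last by rewrite orbT.
apply/orP; right; apply: contrapT => /negP us; apply: no; by exists u.
Qed.

Lemma lower_of_size s n : (forall t : seq V, exists z, z \notin t) ->
    lower s -> uniq s -> size s <= n ->
  exists t, [/\ lower t, uniq t, size t = n & {subset s <= t}].
Proof.
move=> infV ls us; elim: n => [|n IH].
  by rewrite leqn0 => /eqP e; exists s; split.
rewrite leq_eqVlt => /orP[/eqP e|]; first by exists s; split.
case/IH=> t [lt ut st sub]; have [z zt] := infV t.
have [x [xt lx]] := lower_extend zt lt.
exists (x :: t); split=> //=; rewrite ?xt ?st // => y /sub yt.
by rewrite inE yt orbT.
Qed.
End LowerSets.

(** * Concatenated lists and blocks of equal length *)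

Lemma index_take (T : eqType) (x : T) r s :
  x \in take r s -> index x (take r s) = index x s.
Proof. by move=> xs; rewrite -{2}(cat_take_drop r s) index_cat xs. Qed.

(** Concatenation only adds an offset to positions. The inequality carries depth bounds from a
    child's list to its parent's. *)
Lemma flatten_map_index (T U : eqType) (f : U -> seq T) (s : seq U) x :
    x \in flatten (map f s) ->
  exists2 c, c \in s & x \in f c /\ index x (f c) <= index x (flatten (map f s)).
Proof.
elim: s => [//|c s IH] /=; rewrite mem_cat index_cat; case: ifP => [xc _|_ /= /IH].
  by exists c; rewrite ?mem_head.
case=> d ds [xd le]; exists d; first by rewrite inE ds orbT.
by split=> //; apply: leq_trans le (leq_addl _ _).
Qed.

Lemma flatten_map_uniq (T U : eqType) (f : U -> seq T) (s : seq U) :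
    uniq s -> (forall c, c \in s -> uniq (f c)) ->
    (forall c d x, c \in s -> d \in s -> x \in f c -> x \in f d -> c = d) ->
  uniq (flatten (map f s)).
Proof.
elim: s => [//|c s IH] /= /andP[cs us] uf df.
rewrite cat_uniq uf ?mem_head //= IH //; first 1 last.
- by move=> d ds; apply: uf; rewrite inE ds orbT.
- by move=> d e x ds es; apply: df; rewrite inE ?ds ?es orbT.
rewrite andbT; apply/hasPn => x /flatten_map_index[d ds [xd _]].
apply/negP => xc; have e : c = d by apply: (df _ _ x); rewrite ?mem_head // inE ds orbT.
by rewrite e ds in cs.
Qed.

Definition chunk (T : eqType) (n : nat) (s : seq T) (x : T) : seq T :=
  take n (drop (index x s %/ n * n) s).

(** Divisibility makes the last block full. Without repetitions, positions are recovered by [index],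
    so all members of a block have the same quotient by [n]. *)
Lemma chunkP (T : eqType) n (s : seq T) x :
    0 < n -> uniq s -> n %| size s -> x \in s ->
  [/\ uniq (chunk n s x), size (chunk n s x) = n, x \in chunk n s x &
     forall y, y \in chunk n s x -> y \in s /\ chunk n s y = chunk n s x].
Proof.
move=> n_gt0 us ns xs; rewrite /chunk.
set m := index x s %/ n * n; have ltx : index x s < size s by rewrite index_mem.
have mx : m <= index x s by exact: leq_divM.
have idx z : z \in drop m s -> index z s = m + index z (drop m s).
  move=> zd; rewrite -{1}(cat_take_drop m s) index_cat.
  have /negbTE-> : z \notin take m s.
    move: us; rewrite -{1}(cat_take_drop m s) cat_uniq => /and3P[_ /hasPn h _].
    exact: h.
  by rewrite size_takel // ltnW // (leq_ltn_trans mx).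
have xd : x \in drop m s.
  have := xs; rewrite -{1}(cat_take_drop m s) mem_cat in_take //.
  by rewrite ltnNge mx.
split.
- by rewrite take_uniq // drop_uniq.
- rewrite size_takel // size_drop -(divnK ns) -mulnBl leq_pmull // subn_gt0.
  by rewrite ltn_divLR // divnK.
- rewrite in_take // -(ltn_add2l m) -idx // addnC -mulSn; exact: ltn_ceil.
move=> y yc; have yd := mem_take yc; have := yc; rewrite in_take // => yn.
split; first exact: mem_drop yd.
suff -> : index y s %/ n = index x s %/ n by [].
by rewrite (idx _ yd) divnMDl // (divn_small yn) addn0.
Qed.

(** * Packing the points of a forest into blocks *)

Section Blocks.
Variables (V : eqType) (p : V -> V) (X : pred V) (ch : V -> seq V) (n : nat).
Hypothesis n_gt0 : 0 < n.
Hypothesis stableX : forall x, X x -> X (p x).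
Hypothesis chP : forall u v, (u \in ch v) = (p u == v) && X u.
Hypothesis ch_uniq : forall v, uniq (ch v).
Variable height : V -> nat.
Hypothesis heightP : forall v, height_lt (preim_rel p) (height v) v.

(** The fuel [k] is a height bound, so the default at 0 is never reached from a valid one. [pool v]
    is what [v] holds, and [carry v] the surplus modulo [n] that it sends to [p v]. *)
Fixpoint carry_rec (k : nat) (v : V) : seq V :=
  if k is k'.+1 then
    let s := v :: flatten (map (carry_rec k') (ch v)) in take (size s %% n) s
  else [::].

Definition carry v := carry_rec (height v) v.
Definition pool v := v :: flatten (map carry (ch v)).

(** Needed because [height] gives arbitrary bounds: the one for a child need not be that of its
    parent minus one. *)
Lemma carry_rec_stable k m v : height_lt (preim_rel p) k v ->
  height_lt (preim_rel p) m v -> carry_rec k v = carry_rec m v.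
Proof.
elim: k m v => [//|k IH] [//|m] v /= hk hm.
suff -> : map (carry_rec k) (ch v) = map (carry_rec m) (ch v) by [].
apply/eq_in_map => u; rewrite chP => /andP[/eqP pu _].
by apply: IH; [exact: hk | exact: hm].
Qed.

Lemma carryE v : carry v = take (size (pool v) %% n) (pool v).
Proof.
have hv : height_lt (preim_rel p) (height v).+1 v.
  exact: height_lt_leq (leqnSn _) (heightP v).
rewrite /carry (carry_rec_stable (heightP v) hv) /=.
suff -> : map (carry_rec (height v)) (ch v) = map carry (ch v) by [].
apply/eq_in_map => u; rewrite chP => /andP[/eqP pu _].
exact: carry_rec_stable (hv u pu) (heightP u).
Qed.

(** A repetition in an orbit would be a cycle. Hence the distance from a point up to an ancestor is
    well defined. *)
Lemma iter_inj x i j : iter i p x = iter j p x -> i = j.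
Proof.
wlog le_ij : i j / i <= j.
  by move=> H e; case/orP: (leq_total i j) => /H -> //.
move: le_ij; rewrite leq_eqVlt => /orP[/eqP//|ij].
rewrite -(subnK ij) addnS -addSn iterD => /esym.
by move/(height_lt_acyclic (heightP _)).
Qed.

(* The preorder listing [v, carry c_1, carry c_2, ...] places an element at
   distance [d] below [v] at an index at least [d], so that truncating to fewer
   than [n] elements only keeps elements near [v]. *)
Lemma pool_depth v x : x \in pool v ->
  (exists2 j, j <= index x (pool v) & iter j p x = v) /\ (X v -> X x).
Proof.
have := heightP v; move: (height v) => k; elim: k x v => [//|k IH] x v hv.
rewrite inE /=; have [->|_ /=] := eqVneq x v; first by split=> //; exists 0.
case/flatten_map_index=> c; rewrite chP => /andP[/eqP pc Xc].
rewrite carryE => -[xc le]; have [[j lej xj] Xx] := IH _ _ (hv c pc) (mem_take xc).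
split; last by move=> _; exact: Xx.
exists j.+1; last by rewrite iterS xj.
by rewrite ltnS; apply: leq_trans lej _; rewrite -(index_take xc).
Qed.

Lemma carry_pool v : {subset carry v <= pool v}.
Proof. by move=> x; rewrite carryE => /mem_take. Qed.

Lemma carry_depth v x : x \in carry v -> exists2 j, j < n & iter j p x = v.
Proof.
rewrite carryE => xc; have [[j lej xj] _] := pool_depth (mem_take xc).
exists j => //; apply: leq_ltn_trans lej _.
by rewrite (ltn_trans (index_ltn xc)) // ltn_pmod.
Qed.

Lemma pool_uniq v : uniq (pool v).
Proof.
have := heightP v; move: (height v) => k; elim: k v => [//|k IH] v hv /=; apply/andP; split.
  apply/negP => /flatten_map_index[c]; rewrite chP => /andP[/eqP pc _] [vc _].
  have [j _ jv] := carry_depth vc.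
  by have := @iter_inj v j.+1 0; rewrite /= jv => /(_ pc).
apply: flatten_map_uniq => // [c|c d x].
  rewrite chP => /andP[/eqP pc _]; rewrite carryE take_uniq //; exact: IH (hv c pc).
rewrite !chP => /andP[/eqP pc _] /andP[/eqP pd _] /carry_depth[i _ ic].
case/carry_depth=> j _ jd; have [] : i.+1 = j.+1.
  by apply: (@iter_inj x); rewrite /= ic jd pc pd.
by move=> ij; rewrite -ic -jd ij.
Qed.

Lemma pool_succ x j : x \in pool (iter j.+1 p x) -> x \in carry (iter j p x).
Proof.
rewrite inE => /orP[/eqP e|]; first by have := @iter_inj x 0 _ e.
case/flatten_map_index=> c; rewrite chP => /andP[/eqP pc _] [xc _].
have [m _ mc] := carry_depth xc; have [] : m.+1 = j.+1.
  by apply: (@iter_inj x); rewrite iterS mc pc.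
by move=> <-; rewrite mc.
Qed.

(** The home of [x] is the vertex where [x] is held and not sent on. By [pool_succ], to be held
    higher up [x] must have been sent on by every vertex in between. *)
Lemma home_uniq x v w : x \in pool v -> x \notin carry v ->
  x \in pool w -> x \notin carry w -> v = w.
Proof.
move=> xv nv xw nw.
have [[i _ iv] _] := pool_depth xv; have [[j _ jw] _] := pool_depth xw.
subst v w; wlog lt_ij : i j xv nv xw nw / i < j.
  move=> H; have [ij|ji|-> //] := ltngtP i j; first exact: H.
  by apply/esym/H.
suff : x \in carry (iter i p x) by rewrite (negbTE nv).
move: xw {nw}; elim: j lt_ij => [//|j IH]; rewrite ltnS leq_eqVlt.
by case/orP=> [/eqP->|ij] /pool_succ // /carry_pool; exact: IH.
Qed.

(** Otherwise [x] would be sent on by its ancestor at distance [n], while a surplus only contains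
    points at distance less than [n]. *)
Lemma home_exists x : X x -> exists v,
  [/\ x \in pool v, x \notin carry v & exists2 j, j <= n & iter j p x = v].
Proof.
move=> Xx; apply: contrapT => no.
have Xi i : X (iter i p x) by elim: i => //= i /stableX.
have up i : i <= n -> x \in pool (iter i p x) -> x \in carry (iter i p x).
  move=> le xi; apply: contrapT => /negP nx; apply: no.
  by exists (iter i p x); split=> //; exists i.
have xp i : i <= n -> x \in pool (iter i p x).
  elim: i => [|i IH] le; first exact: mem_head.
  rewrite inE; apply/orP; right; apply/flattenP; exists (carry (iter i p x)).
    by apply: map_f; rewrite chP Xi andbT.
  by apply: up; [exact: ltnW | exact/IH/ltnW].
have [j ltj /iter_inj e] := carry_depth (up n (leqnn n) (xp n (leqnn n))).
by rewrite e ltnn in ltj.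
Qed.

(** The points with home [v] are [pool v] minus its prefix [carry v], a multiple of [n] in number,
    and are cut into chunks. The common home is the ancestor within [n] steps that bounds the shape
    of a block. *)
Lemma block_partition : exists P : V -> seq V, forall x, X x ->
  [/\ uniq (P x), size (P x) = n, x \in P x & forall y, y \in P x ->
     [/\ X y, P y = P x &
       exists i j, [/\ i <= n, j <= n & iter i p x = iter j p y]]].
Proof.
have /choice [home homeP] : forall x, exists v, X x ->
    [/\ x \in pool v, x \notin carry v & exists2 j, j <= n & iter j p x = v].
  move=> x; case Xx: (X x); last by exists x.
  by have [v vP] := home_exists Xx; exists v.
pose rest v := drop (size (pool v) %% n) (pool v).
have restP v x : (x \in rest v) = (x \in pool v) && (x \notin carry v).
  have := pool_uniq v; rewrite carryE /rest; move: (pool v) => s; move: (_ %% n) => r.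
  rewrite -{1 3}(cat_take_drop r s) cat_uniq mem_cat => /and3P[_ /hasPn h _].
  case xr: (x \in drop r s); first by rewrite (negbTE (h x xr)) orbT.
  by rewrite orbF andbN.
exists (fun x => chunk n (rest (home x)) x) => x Xx.
have [xp xc [i lei ix]] := homeP x Xx.
have ur : uniq (rest (home x)) by rewrite drop_uniq // pool_uniq.
have nr : n %| size (rest (home x)).
  rewrite size_drop [X in X - _](divn_eq _ n) addnK; exact: dvdn_mull.
have xr : x \in rest (home x) by rewrite restP xp.
have [? ? ? cP] := chunkP n_gt0 ur nr xr.
split=> // y /cP[]; rewrite restP => /andP[yp yc] yx.
have [_ Xyh] := pool_depth yp.
have Xy : X y.
  by apply: Xyh; rewrite -ix; elim: i {lei ix} => //= i /stableX.
have [yp' yc' [j lej jy]] := homeP y Xy.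
have e := home_uniq yp' yc' yp yc.
by split; [| rewrite e | exists i, j; rewrite ix jy e].
Qed.
End Blocks.

(** * From partitions with bounded blocks to polytiles *)

Section GroupTilings.
Variables (G : choiceType) (gr : group_str G).
Local Notation "x ** y" := (gmul gr x y) (at level 40, left associativity).
Local Notation inv := (ginv gr).
Local Notation e := (gone gr).

Lemma gmulgV x : x ** inv x = e.
Proof.
by rewrite -[LHS](gmul1g gr) -(gmulVg gr (inv x)) -gmulA (gmulA gr (inv x)) gmulVg gmul1g.
Qed.

Lemma gmulg1 x : x ** e = x.
Proof. by rewrite -(gmulVg gr x) gmulA gmulgV gmul1g. Qed.

Lemma gmulKg x y : inv x ** (x ** y) = y.
Proof. by rewrite gmulA gmulVg gmul1g. Qed.

Lemma gmulVKg x y : x ** (inv x ** y) = y.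
Proof. by rewrite gmulA gmulgV gmul1g. Qed.

Lemma ginv_eq x y : x ** y = e -> inv x = y.
Proof. by move=> xy; rewrite -(gmulKg x y) xy gmulg1. Qed.

Lemma ginvK x : inv (inv x) = x.
Proof. by apply: ginv_eq; rewrite gmulVg. Qed.

Lemma ginvM x y : inv (x ** y) = inv y ** inv x.
Proof. by apply: ginv_eq; rewrite -gmulA gmulVKg gmulgV. Qed.

Lemma ginv1 : inv e = e.
Proof. by apply: ginv_eq; rewrite gmul1g. Qed.

(** Each block is translated back by a base point in it. The resulting shapes lie in the finite set
    [B], so they are finitely many; [Delta i] collects the base points of the blocks of shape
    [T i]. *)
Lemma polytile_of_partition (P : G -> seq G) (n : nat) (B : seq G) :
    0 < n ->
    (forall x, [/\ uniq (P x), size (P x) = n, x \in P x &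
       forall y, y \in P x -> P y = P x]) ->
    (forall x y, y \in P x -> inv x ** y \in B) ->
  exists k T, [/\ fair_polytile gr k T, #|` T 0| = n & {subset P e <= T 0}].
Proof.
move=> n_gt0 PP PB.
(* Basing the block of [e] at [e] itself makes its shape equal to [P e]. Elsewhere any choice
   depending only on the list [P x] would do. *)
pose b x := if e \in P x then e else head e (P x).
have bP x : b x \in P x.
  rewrite /b; case: ifP => // _; have [_ sz _ _] := PP x.
  by case: (P x) sz n_gt0 => [<-|y s _ _] //=; rewrite mem_head.
have b_eq x y : y \in P x -> b y = b x.
  by have [_ _ _ h] := PP x => /h; rewrite /b => ->.
pose sh x := [fset y in [seq inv (b x) ** y | y <- P x]]%fset.
have shE x y : (b x ** y \in P x) = (y \in sh x).
  rewrite in_fset; apply/idP/mapP => [yx|[z zx ->]]; last by rewrite gmulVKg.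
  by exists (b x ** y); rewrite ?gmulKg.
have sh_eq x y : y \in P x -> sh y = sh x.
  by move=> yx; have [_ _ _ h] := PP x; rewrite /sh (b_eq _ _ yx) (h y yx).
have card_sh x : #|` sh x| = n.
  have [ux sz _ _] := PP x.
  rewrite card_fseq undup_id ?size_map // map_inj_uniq // => y z /(congr1 (gmul gr (b x))).
  by rewrite !gmulVKg.
(* The shape of [P e] gets index 0. Keeping only shapes that occur makes every [Delta i] non-empty;
   listing each once makes the index unique. *)
pose ts := sh e :: [seq t <- fpowerset [fset y in B]%fset |
                     `[< exists x, sh x = t >] && (t != sh e)].
have uts : uniq ts by rewrite /= mem_filter eqxx andbF /= filter_uniq // fset_uniq.
have tsP t : t \in ts <-> exists x, sh x = t.
  rewrite inE mem_filter; split=> [/orP[/eqP->|/andP[/andP[/asboolP]]]//|[x <-]].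
    by exists e.
  case: eqVneq => //= ne; rewrite andbT; apply/andP; split.
    by apply/asboolP; exists x.
  rewrite fpowersetE; apply/fsubsetP => y; rewrite -shE in_fset => yx.
  rewrite -(gmulKg (b x) y); apply: PB.
  by have [_ _ _ h] := PP x; rewrite (h _ (bP x)).
pose T i := nth fset0 ts i.
have TP i : i < size ts -> exists x, sh x = T i by move=> li; apply/tsP/mem_nth.
exists (size ts), T; split; last first.
- move=> y; rewrite /T /= -shE /b.
  by have [_ _ -> _] := PP e; rewrite gmul1g.
- exact: card_sh.
split; last by move=> i /TP[x <-]; rewrite [RHS]card_sh.
split=> //; split=> [i /TP[x <-]|]; first by rewrite -shE gmulg1.
exists (fun i d => exists x, d = b x /\ sh x = T i); split; last split.
- by move=> i /TP[x xi]; exists (b x), x.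
- move=> x; have xts : sh x \in ts by apply/tsP; exists x.
  exists (index (sh x) ts), (b x); split; first by rewrite index_mem.
    by exists x; rewrite /T nth_index.
  exists (inv (b x) ** x); last by rewrite gmulVKg.
  by rewrite /T nth_index // -shE gmulVKg; have [_ _ ->] := PP x.
move=> z i j _ _ li lj [x [-> xi]] [y [-> yj]] [s sx ->] [t ty zE].
have zx : b x ** s \in P x by rewrite shE xi.
have zy : b x ** s \in P y by rewrite zE shE yj.
split; last by rewrite -(b_eq _ _ zx) (b_eq _ _ zy).
apply/eqP; rewrite -(nth_uniq fset0 li lj uts) -/(T i) -/(T j) -xi -yj.
by rewrite -(sh_eq _ _ zx) (sh_eq _ _ zy).
Qed.

(** * Word metric and flow along the Cayley graph *)

Section SymmetricGenerators.
Variable S : seq G.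
Hypothesis S1 : e \in S.
Hypothesis SV : forall s, s \in S -> inv s \in S.

(** Words of length exactly [m]; since [e] is in [S], this is the ball of radius [m] in the word
    metric. *)
Fixpoint ball (m : nat) : seq G :=
  if m is m'.+1 then [seq x ** s | x <- ball m', s <- S] else [:: e].

Lemma ball_succ m x s : x \in ball m -> s \in S -> x ** s \in ball m.+1.
Proof. by move=> xm sS; apply/allpairsP; exists (x, s). Qed.

Lemma ball_leq i j : i <= j -> {subset ball i <= ball j}.
Proof.
move=> /subnKC <-; elim: (j - i) => [|d IH] x; first by rewrite addn0.
by move=> /IH xd; rewrite addnS -(gmulg1 x); exact: ball_succ.
Qed.

Lemma ball_mul i j x y : x \in ball i -> y \in ball j -> x ** y \in ball (i + j).
Proof.
move=> xi; elim: j y => [|j IH] y; first by rewrite inE addn0 => /eqP->; rewrite gmulg1.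
by case/allpairsP=> -[z s] /= [/IH zj sS ->]; rewrite gmulA addnS; exact: ball_succ.
Qed.

Lemma ball_gen s : s \in S -> s \in ball 1.
Proof. by move=> sS; rewrite -(gmul1g gr s); apply: ball_succ; rewrite ?inE. Qed.

Lemma ball_inv i x : x \in ball i -> inv x \in ball i.
Proof.
elim: i x => [|i IH] x; first by rewrite !inE => /eqP->; rewrite ginv1.
case/allpairsP=> -[z s] /= [/IH zi /SV/ball_gen sS ->].
by rewrite ginvM; exact: ball_mul sS zi.
Qed.

(* Breadth-first search from a chosen representative of every left coset of the
   subgroup generated by [S]. *)
Lemma coset_bfs_forest : exists (rep q : G -> G) (l : G -> nat),
  [/\ forall x, inv (rep x) ** x \in ball (l x),
      forall x m h, h \in ball m -> rep (x ** h) = rep x,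
      forall x m, inv (rep x) ** x \in ball m -> l x <= m,
      forall x, inv x ** q x \in S &
      forall x, 0 < l x -> rep (q x) = rep x /\ l x = (l (q x)).+1].
Proof.
pose inH x := exists m, x \in ball m.
have inHM x y : inH x -> inH y -> inH (x ** y).
  by move=> [i xi] [j yj]; exists (i + j)%N; exact: ball_mul.
have inHV x : inH x -> inH (inv x) by move=> [i /ball_inv xi]; exists i.
pose cos x := fun y => `[< inH (inv y ** x) >].
have cos_refl x : cos x x by apply/asboolP; rewrite gmulVg; exists 0; rewrite inE.
(* [choose] agrees on equivalent predicates, so the representative depends only on the coset. *)
pose rep x := choose (cos x) x.
have repH x : inH (inv (rep x) ** x) by apply/asboolP; exact: chooseP (cos_refl x).
have repM x h : inH h -> rep (x ** h) = rep x.
  move=> hH; have cosE : cos (x ** h) =1 cos x.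
    move=> y; apply/asboolP/asboolP; rewrite gmulA => yx; last exact: inHM.
    by have := inHM _ _ yx (inHV _ hH); rewrite -gmulA gmulgV gmulg1.
  by rewrite /rep (eq_choose cosE); apply: choose_id; rewrite // -cosE.
pose l x := ex_minn (repH x).
have lP x : inv (rep x) ** x \in ball (l x) by rewrite /l; case: ex_minnP.
have l_min x m : inv (rep x) ** x \in ball m -> l x <= m.
  by rewrite /l; case: ex_minnP => k _; exact.
have /choice [q qP] : forall x, exists y, inv x ** y \in S /\
    (0 < l x -> rep y = rep x /\ l x = (l y).+1).
  move=> x; case lx : (l x) => [|m]; first by exists x; rewrite gmulVg.
  have := lP x; rewrite lx => /allpairsP[[z s] /= [zm sS E]].
  (* The parent is found by deleting the last letter [s] of a shortest word leading from [rep x] to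
     [x]. *)
  exists (x ** inv s); rewrite gmulKg; split; first exact: SV.
  move=> _; have rs : rep (x ** inv s) = rep x.
    by apply: repM; exists 1; apply/ball_gen/SV.
  have xz : inv (rep x) ** (x ** inv s) = z by rewrite gmulA E -gmulA gmulgV gmulg1.
  split=> //; congr _.+1; apply/eqP; rewrite eqn_leq l_min ?rs ?xz // andbT.
  rewrite -ltnS -lx; apply: l_min.
  have := ball_succ (lP (x ** inv s)) sS; rewrite rs xz -E.
  exact.
exists rep, q, l; split=> // [x m h hm|x|x /(proj2 (qP x))//].
  by apply: repM; exists m.
exact: (proj1 (qP x)).
Qed.

(** A root of height below [k] would have its whole coset within distance [k], but the subgroup is
    infinite; so [flow_to_infinity] applies. Its steps go up or down along [q], hence by generators,
    as [S] is symmetric. *)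
Lemma coset_flow : (forall s : seq G, exists m h, h \in ball m /\ h \notin s) ->
  exists p : G -> G, (forall x, inv x ** p x \in S) /\
    forall v, exists k, height_lt (preim_rel p) k v.
Proof.
move=> infH; have [rep [q [l [lP repM l_min qS qP]]]] := coset_bfs_forest.
pose nb v := [seq v ** s | s <- S].
have nbP u : u \in nb (q u).
  apply/mapP; exists (inv (inv u ** q u)); first exact: SV.
  by rewrite ginvM ginvK gmulVKg.
have root r k : l r = 0 -> ~ height_lt (fun u v => q u = v /\ l u = (l v).+1) k r.
  move=> lr hr; have [m [h [hm hk]]] := infH (ball k).
  have rE : rep r = r.
    by have := lP r; rewrite lr inE => /eqP/ginv_eq; rewrite ginvK.
  have up x j : j <= l x -> rep (iter j q x) = rep x /\ l x = l (iter j q x) + j.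
    elim: j => [|j IH] lj; first by rewrite addn0.
    have [rj lj'] := IH (ltnW lj).
    have [] := qP (iter j q x); first by rewrite -(ltn_add2r j) add0n -lj'.
    by move=> r1 l1; rewrite /= r1 rj {1}lj' l1 addSnnS.
  have down k' v x j : height_lt (fun u v => q u = v /\ l u = (l v).+1) k' v ->
      iter j q x = v -> j <= l x -> j < k'.
    elim: k' v j => [//|k' IH] v [//|j] /= hv jv lj.
    apply: IH (ltnW lj) => //; apply: hv; split=> //.
    have [_ lj1] := up x j (ltnW lj); have [_] := up x j.+1 lj.
    rewrite {1}lj1 /= jv; rewrite addnS -addSn; exact: addIn.
  have rh : rep (r ** h) = r by rewrite (repM _ m).
  have gh : inv (rep (r ** h)) ** (r ** h) = h by rewrite rh gmulKg.
  have [rtop ltop] := up (r ** h) _ (leqnn _).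
  have top : iter (l (r ** h)) q (r ** h) = r.
    have l0 : l (iter (l (r ** h)) q (r ** h)) = 0.
      by apply: (@addIn (l (r ** h))); rewrite add0n -ltop.
    have := lP (iter (l (r ** h)) q (r ** h)); rewrite l0 rtop rh inE.
    by move/eqP/ginv_eq; rewrite ginvK => <-.
  have lt := down _ _ _ _ hr top (leqnn _).
  by case/negP: hk; have := lP (r ** h); rewrite gh; apply: ball_leq; exact: ltnW.
have [|p [pq ph]] := flow_to_infinity _ nbP root; first by move=> v /qP[].
exists p; split=> // x; case: (pq x) => [->|E]; first exact: qS.
have := SV (qS (p x)); by rewrite E ginvM ginvK.
Qed.

(** * Polytiles from a flow *)

Section Flow.
Variable p : G -> G.
Hypothesis pS : forall x, inv x ** p x \in S.
Hypothesis height : forall v, exists k, height_lt (preim_rel p) k v.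

Lemma flow_preim u : u \in [seq p u ** s | s <- S].
Proof.
apply/mapP; exists (inv (inv u ** p u)); first exact: SV.
by rewrite ginvM ginvK gmulVKg.
Qed.

Lemma flow_ball j x : inv x ** iter j p x \in ball j.
Proof.
elim: j => [|j IH]; first by rewrite /= gmulVg inE.
by have := ball_succ IH (pS (iter j p x)); rewrite -gmulA gmulVKg.
Qed.

(** As [D] is closed under preimages, the flow preserves its complement, which is packed into
    blocks. A non-empty [D] is one more block, and contains [e], so it becomes the tile of index
    0. *)
Lemma flow_polytile (D : seq G) n : 0 < n -> lower p D -> uniq D ->
    (D = [::] \/ e \in D /\ size D = n) ->
  exists k T, [/\ fair_polytile gr k T, #|` T 0| = n & {subset D <= T 0}].
Proof.
move=> n_gt0 lD uD DP; have /choice [ht htP] := height.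
pose ch v := [seq u <- undup [seq v ** s | s <- S] | (p u == v) && (u \notin D)].
have chP u v : (u \in ch v) = (p u == v) && (u \notin D).
  rewrite mem_filter mem_undup andbC; case: eqVneq => /= [<-|_]; last by rewrite andbF.
  by rewrite flow_preim.
have ch_uniq v : uniq (ch v) by rewrite filter_uniq // undup_uniq.
have stable x : x \notin D -> p x \notin D by apply: contra; exact: lD.
have [P PP] := block_partition (X := fun x => x \notin D) n_gt0 stable chP ch_uniq htP.
pose Q x := if x \in D then D else P x.
(* Outside [D], two points of a block meet after at most [n] steps each, so they differ by an
   element of [ball n] times an inverse of one. *)
pose B := [seq a ** inv b | a <- ball n, b <- ball n] ++ [seq inv x ** y | x <- D, y <- D].
have sD x : x \in D -> size D = n by case: DP => [->|[]].
have QP x : [/\ uniq (Q x), size (Q x) = n, x \in Q x & forall y, y \in Q x -> Q y = Q x].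
  rewrite /Q; case: ifPn => xD.
    by split=> // [|y ->//]; exact: sD xD.
  have [? ? ? h] := PP x xD; split=> // y /h[yD -> _].
  by rewrite (negbTE yD).
have QB x y : y \in Q x -> inv x ** y \in B.
  rewrite /Q mem_cat; case: ifPn => [xD yD|xD].
    by apply/orP; right; apply/allpairsP; exists (x, y).
  have [_ _ _ h] := PP x xD => /h[_ _ [i [j [le_i le_j ij]]]].
  apply/orP; left; apply/allpairsP.
  exists (inv x ** iter i p x, inv y ** iter j p y); split=> /=.
  - exact: ball_leq le_i _ (flow_ball i x).
  - exact: ball_leq le_j _ (flow_ball j y).
  - by rewrite ginvM ginvK ij -gmulA gmulVKg.
have [k [T [fT cT sT]]] := polytile_of_partition n_gt0 QP QB.
exists k, T; split=> // x xD; apply: sT; rewrite /Q.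
by case: DP xD => [->//|[-> _]].
Qed.
End Flow.
End SymmetricGenerators.

(** * Groups that are not locally finite *)

Lemma not_locally_finite_flow : ~ locally_finite gr ->
  exists (S : seq G) (p : G -> G),
    [/\ e \in S, forall s, s \in S -> inv s \in S, forall x, inv x ** p x \in S &
        forall v, exists k, height_lt (preim_rel p) k v].
Proof.
move=> /existsNP[A] /forallNP nA.
pose S := e :: (enum_fset A) ++ map inv (enum_fset A).
have S1 : e \in S by exact: mem_head.
have AS a : a \in A -> a \in S by rewrite inE mem_cat orbC => ->.
have SV s : s \in S -> inv s \in S.
  rewrite !inE !mem_cat => /orP[/eqP->|/orP[sA|/mapP[a aA ->]]].
  - by rewrite ginv1 eqxx.
  - by rewrite map_f ?orbT.
  - by rewrite ginvK aA ?orbT.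
have genS x : generated gr (fun y => y \in A) x -> exists m, x \in ball S m.
  elim=> {x} [x /AS xS||x y _ [i xi] _ [j yj]|x _ [i xi]].
  - by exists 1; exact: ball_gen.
  - by exists 0; rewrite inE.
  - by exists (i + j)%N; exact: ball_mul.
  - by exists i; exact: ball_inv.
have [|p [pS ph]] := coset_flow S1 SV; last by exists S, p.
move=> s; have /existsNP[x /not_implyP[/genS[m xm] xs]] := nA s.
by exists m, x; split=> //; apply/negP.
Qed.

Lemma not_locally_finite_infinite : ~ locally_finite gr ->
  forall s : seq G, exists z, z \notin s.
Proof.
move=> nlf s; apply: contrapT => no; apply: nlf => A; exists s => x _.
by apply: contrapT => /negP xs; apply: no; exists x.
Qed.
End GroupTilings.

Unset Implicit Arguments.
Local Open Scope fset_scope.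

Theorem theorem6p5 (G : countType) (gr : group_str G) :
  ~ locally_finite gr ->
  (forall n : nat, 1 <= n ->
     exists (k : nat) (T : nat -> {fset G}), fair_polytile gr k T /\ #|` T 0| = n) /\
  (forall F : {fset G}, exists N : nat, forall n : nat, N <= n ->
     exists (k : nat) (T : nat -> {fset G}),
       [/\ fair_polytile gr k T, F `<=` T 0 & #|` T 0| = n]).
Proof.
move=> nlf; have [S [p [S1 SV pS ph]]] := not_locally_finite_flow nlf.
split=> [n n_gt0|F].
  (* With no prescribed points, the empty set is removed. *)
  have l0 : lower p [::] by [].
  have [k [T [fT cT _]]] := flow_polytile S1 SV pS ph n_gt0 l0 isT (or_introl erefl).
  by exists k, T.
have [s [ls sP]] := lower_cover (nb := fun v => [seq gmul gr v s | s <- S])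
  (flow_preim SV pS) ph (gone gr :: enum_fset F).
have lu : lower p (undup s) by move=> u; rewrite !mem_undup; exact: ls.
(* The threshold is the size of a closed set containing [F] and the identity, which can then be
   enlarged to any size [n] above it. *)
exists (size (undup s)) => n le_n.
have [t [lt ut st sub]] :=
  lower_of_size ph (not_locally_finite_infinite nlf) lu (undup_uniq s) le_n.
have st' x : x \in s -> x \in t by move=> xs; apply: sub; rewrite mem_undup.
have t1 : gone gr \in t by apply/st'/sP/mem_head.
have n_gt0 : 0 < n by rewrite -st; case: (t) t1.
have [k [T [fT cT sT]]] :=
  flow_polytile S1 SV pS ph n_gt0 lt ut (or_intror (conj t1 st)).
exists k, T; split=> //; apply/fsubsetP => x xF.
by apply/sT/st'/sP; rewrite inE xF orbT.
Qed.
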